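(* Realizability, I-realizability and B-realizability all refer to $\mathbb{N}_0$. (a) Let $n=2$, $m^{(2)}=(m_1,m_2)\in\mathbb{R}^2$, and suppose $m^{(1)}$ is I-realizable (that is, $m_1>0$). Put $k_1=\lfloor m_1\rfloor$ and $\theta_1=m_1-k_1$. Then $$P_2^{(m)}(x)=(x-k_1)(x-k_1-1)$$ is a minimizing polynomial for $m^{(2)}$, and $m^{(2)}$ is realizable if and only if $$m_2-m_1^2\ge\theta_1(1-\theta_1).$$ In particular, $m^{(2)}$ is I-realizable if this inequality is strict, and B-realizable if equality holds. (b) Let $n=3$, $m^{(3)}=(m_1,m_2,m_3)\in\mathbb{R}^3$, and suppose $m^{(2)}$ is I-realizable (that is, by (a), $m_1>0$ and $m_2-m_1^2>\theta_1(1-\theta_1)$). Put $k_2=\lfloor m_2/m_1\rfloor$ and $\theta_2=m_2/m_1-k_2$. Then $$P_3^{(m)}(x)=x(x-k_2)(x-k_2-1)$$ is a minimizing polynomial for $m^{(3)}$, and $m^{(3)}$ is realizable if and only if $$\frac{m_3}{m_1}-\left(\frac{m_2}{m_1}\right)^2\ge\theta_2(1-\theta_2).$$ In particular, when $m^{(3)}$ is realizable it is I-realizable if this inequality is strict, and B-realizable otherwise.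
   Context: $\mathbb{N}_0=\{0,1,2,\dots\}$. A moment vector $m=(m_1,\dots,m_n)$ is an $n$-tuple of real numbers; by convention $m_0=1$, and $m^{(j)}=(m_1,\dots,m_j)$ for $j\le n$. It is realizable (on $\mathbb{N}_0$) if there is a probability measure $\mu$ on $\mathbb{N}_0$ with $\int x^k\,d\mu(x)=m_k$ for $k=1,\dots,n$. For a polynomial $P(x)=\sum_{k=0}^n p_kx^k$ of degree at most $n$, $L_P(m)=\sum_{k=0}^n p_km_k$. For $k\ge 0$, $\mathcal{P}_k$ denotes the set of monic polynomials of degree $k$ which have $k$ distinct roots in $\mathbb{N}_0$ and are nonnegative on $\mathbb{N}_0$ (so $\mathcal{P}_0=\{1\}$). A realizable moment vector $m^{(n)}$ is I-realizable if $L_P(m)>0$ for all $P\in\mathcal{P}_n\cup\mathcal{P}_{n-1}$; otherwise it is B-realizable. A minimizing polynomial for $m^{(n)}$, denoted $P_n^{(m)}$ (not necessarily unique), is an element of $\mathcal{P}_n$ with $L_{P_n^{(m)}}(m)\le L_P(m)$ for all $P\in\mathcal{P}_n$. *)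

(* Defs.v *)
From HB Require Import structures.
From mathcomp Require Import all_boot all_order all_algebra.
From mathcomp Require Import all_classical all_reals all_analysis.

Set Implicit Arguments.
Unset Strict Implicit.
Unset Printing Implicit Defensive.

Import Order.TTheory GRing.Theory Num.Theory.

Local Open Scope classical_set_scope.
Local Open Scope ring_scope.

(* The tuple [tuple m_1; ...; m_n] is extended by the convention m_0 = 1. *)
Definition moment (R : realType) (n : nat) (m : n.-tuple R) (k : nat) : R :=
  nth 0 (1 :: m) k.

(* x |-> x ^+ k is nonnegative on nat, so the finite value of the integral
   includes the integrability of x ^+ k. *)
Definition realizable (R : realType) (n : nat) (m : n.-tuple R) : Prop :=
  exists mu : probability nat R,
    forall k : nat, (1 <= k <= n)%N ->
      (\int[mu]_x ((x%:R : R) ^+ k)%:E = (moment m k)%:E)%E.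

Definition Lfun (R : realType) (n : nat) (P : {poly R}) (m : n.-tuple R) : R :=
  \sum_(k < n.+1) P`_k * moment m k.

Definition monic_nonneg (R : realType) (k : nat) : set {poly R} :=
  [set P | [/\ P \is monic, size P = k.+1,
    (exists s : seq nat,
       [/\ uniq s, size s = k & forall i, i \in s -> root P i%:R]) &
    forall x : nat, 0 <= P.[x%:R]]].

(* Only meaningful for 0 < n, because of the index n - 1. *)
Definition I_realizable (R : realType) (n : nat) (m : n.-tuple R) : Prop :=
  realizable m /\
  forall P : {poly R}, (@monic_nonneg R n `|` @monic_nonneg R n.-1) P ->
    0 < Lfun P m.

Definition B_realizable (R : realType) (n : nat) (m : n.-tuple R) : Prop :=
  realizable m /\ ~ I_realizable m.

Definition minimizing (R : realType) (n : nat) (m : n.-tuple R)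
    (P : {poly R}) : Prop :=
  monic_nonneg n P /\
  forall Q : {poly R}, monic_nonneg n Q -> Lfun P m <= Lfun Q m.

(* Main.v *)
(* Realizability forces [L_P(m) >= 0] for every polynomial [P] nonnegative on
   the naturals, in particular for [(x - k)(x - k - 1)] and
   [x (x - k)(x - k - 1)]; these are the only elements of P_2 and P_3, and
   [L_P(m)] is then a quadratic in the integer [k].  Conversely, when the
   minimum is nonnegative, a measure is obtained by putting mass on [k], [k + 1] (and on
   [0] for three moments) and letting a small mass at a distant point absorb
   the excess of the last moment.  The point [k] is taken with
   [k < m_1 <= k + 1] (resp. [k < m_2 / m_1 <= k + 1]) instead of the floor, so
   that the mass at [k + 1] is positive and can be decreased; both choices
   give the same value of [theta (1 - theta)]. *)
Require Import Defs.
From HB Require Import structures.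
From mathcomp Require Import all_boot all_order all_algebra.
From mathcomp Require Import all_classical all_reals all_analysis.
From mathcomp Require Import ring lra.

Set Implicit Arguments.
Unset Strict Implicit.
Unset Printing Implicit Defensive.

Import Order.TTheory GRing.Theory Num.Theory.

Local Open Scope classical_set_scope.
Local Open Scope ring_scope.

(** * Finitely supported measures and nonnegativity of [Lfun] *)

Lemma realizable_atoms (R : realType) (n : nat) (m : n.-tuple R)
    (s : seq (R * nat)) :
  (forall p, p \in s -> 0 <= p.1) -> \sum_(p <- s) p.1 = 1 ->
  (forall k, (1 <= k <= n)%N ->
     \sum_(p <- s) p.1 * p.2%:R ^+ k = moment m k) ->
  realizable m.
Proof.
move=> s0 s1 sm.
(* The absolute value only serves to make the weight nonnegative at every index; [wE] removes it on
   the indices in range. *)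
pose w i := NngNum (normr_ge0 (nth (0, 0%N) s i).1).
have wE i : (i < size s)%N -> (w i)%:num = (nth (0, 0%N) s i).1.
  by move=> si; rewrite /= ger0_norm//; apply: s0; exact: mem_nth.
pose mu : {measure set nat -> \bar R} :=
  msum (fun i => mscale (w i) \d_((nth (0, 0%N) s i).2)) (size s).
have muE (f : nat -> R) : (forall x, 0 <= f x) ->
    (\int[mu]_x (f x)%:E = (\sum_(p <- s) p.1 * f p.2)%:E)%E.
  move=> f0; rewrite ge0_integral_measure_sum//; last first.
    by move=> x _; rewrite lee_fin.
  rewrite (big_nth (0, 0%N)) big_mkord -sumEFin; apply: eq_bigr => i _.
  rewrite ge0_integral_mscale//; last by move=> x _; rewrite lee_fin.
  by rewrite integral_dirac// diracT mul1e -EFinM wE.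
have muT : mu setT = 1%E.
  rewrite -(mul1e (mu _)) -integral_cst// (muE (fun=> 1))//.
  by under eq_bigr do rewrite mulr1; rewrite s1.
pose P : probability nat R := HB.pack (Measure.sort mu)
  (Measure_isProbability.Build _ _ _ mu muT).
exists P => k kn; rewrite -sm//; apply: (muE (fun x => x%:R ^+ k)) => x.
exact: exprn_ge0.
Qed.

Lemma integral_poly (R : realType) (n : nat) (m : n.-tuple R)
    (mu : probability nat R) (P : {poly R}) : (size P <= n.+1)%N ->
  (forall k : nat, (1 <= k <= n)%N ->
      (\int[mu]_x ((x%:R : R) ^+ k)%:E = (moment m k)%:E)%E) ->
  (\int[mu]_x (P.[x%:R])%:E = (Defs.Lfun P m)%:E)%E.
Proof.
move=> sP hm.
have mk (k : 'I_n.+1) : (\int[mu]_x ((x%:R : R) ^+ k)%:E = (moment m k)%:E)%E.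
  case: k => -[|k] /= kn; last exact: hm.
  under eq_integral do rewrite expr0.
  rewrite integral_cst// mul1e; exact: probability_setT.
have ik (k : 'I_n.+1) : mu.-integrable setT (fun x : nat => (x%:R ^+ k)%:E).
  apply/integrableP; split=> //.
  by rewrite integral_fin_num_abs// mk.
under eq_integral do rewrite (horner_coef_wide _ sP) -sumEFin.
rewrite integral_sum//; last first.
  move=> k; under eq_fun do rewrite EFinM; exact: integrableZl.
rewrite -sumEFin; apply: eq_bigr => k _.
under eq_integral do rewrite EFinM.
by rewrite integralZl// mk.
Qed.

Lemma realizable_Lfun_ge0 (R : realType) (n : nat) (m : n.-tuple R)
    (P : {poly R}) :
  (size P <= n.+1)%N -> (forall x : nat, 0 <= P.[x%:R]) ->
  realizable m -> 0 <= Defs.Lfun P m.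
Proof.
move=> sP P0 [mu hm]; rewrite -lee_fin -(integral_poly sP hm).
by apply: integral_ge0 => x _; rewrite lee_fin.
Qed.

(** * Classification of P_1, P_2 and P_3 *)

(** A monic polynomial of degree k with k distinct roots is the product of its linear factors;
    sorting the roots lets the gaps between them be examined in order. *)
Lemma monic_nonnegP (R : realType) (k : nat) (P : {poly R}) :
  monic_nonneg k P <->
  exists s : seq nat, [/\ sorted ltn s, size s = k,
    P = \prod_(a <- s) ('X - a%:R%:P) & forall x : nat, 0 <= P.[x%:R]].
Proof.
split=> [[Pm Ps [s [us ss rs]] P0]|[s [ls ss PE P0]]].
- exists (sort leq s); rewrite ltn_sorted_uniq_leq sort_uniq us size_sort ss.
  split=> //; first exact/sort_sorted/leq_total.
  rewrite (perm_big s) ?perm_sort//=.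
  have := @all_roots_prod_XsubC _ P [seq a%:R | a <- s].
  rewrite size_map Ps ss (monicP Pm) scale1r big_map; apply=> //.
    by apply/allP => _ /mapP[a /rs ra ->].
  rewrite uniq_rootsE map_inj_uniq//; exact/mulrIn/oner_neq0.
- split=> //.
  + by rewrite PE monic_prod_XsubC.
  + by rewrite PE size_prod_XsubC ss.
  + exists s; split=> //.
      by move: ls; rewrite ltn_sorted_uniq_leq => /andP[].
    by move=> i si; rewrite PE -(big_map _ xpredT (fun z => 'X - z%:P))
         root_prod_XsubC map_f.
Qed.

(** No integer lies strictly between [a] and [a + 1]. *)
Lemma consecutive_roots_ge0 (R : realDomainType) (a x : nat) :
  0 <= (x%:R - a%:R) * (x%:R - a%:R - 1) :> R.
Proof.
have [xa|ax] := leqP x a.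
  have : x%:R <= a%:R :> R by rewrite ler_nat.
  nra.
have : a%:R + 1 <= x%:R :> R by rewrite natr1 ler_nat.
nra.
Qed.

Lemma monic_nonneg1 (R : realType) (P : {poly R}) :
  monic_nonneg 1 P <-> P = 'X.
Proof.
split=> [/monic_nonnegP[s [+ + PE P0]]|->].
  case: s PE => [|a []]//= PE _ _; have := P0 0%N.
  rewrite PE big_seq1 !hornerE oppr_ge0 lern0 => /eqP ->.
  by rewrite subr0.
apply/monic_nonnegP; exists [:: 0%N]; split=> //.
  by rewrite big_seq1 subr0.
by move=> x; rewrite hornerX.
Qed.

Lemma XsubC_natS (R : nzRingType) (a : nat) :
  'X - a.+1%:R%:P = 'X - a%:R%:P - 1 :> {poly R}.
Proof. by rewrite -natr1 polyCD opprD addrA. Qed.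

Lemma monic_nonneg2 (R : realType) (P : {poly R}) :
  monic_nonneg 2 P <->
  exists a : nat, P = ('X - a%:R%:P) * ('X - a%:R%:P - 1).
Proof.
split=> [/monic_nonnegP[s [+ + PE P0]]|[a PE]].
  case: s PE => [|a [|b []]]//= PE /[1!andbT] ab _; exists a; rewrite PE.
  suff -> : b = a.+1 by rewrite !big_cons big_nil mulr1 XsubC_natS.
  apply/eqP; rewrite eqn_leq ab andbT leqNgt; apply/negP => ba.
  (* If [b > a + 1], then [a + 1] lies strictly between the roots, where the quadratic is
     negative. *)
  have := P0 a.+1; rewrite PE !big_cons big_nil !hornerE /= -natr1.
  have : a%:R + 1 + 1 <= b%:R :> R by rewrite !natr1 ler_nat.
  nra.
apply/monic_nonnegP; exists [:: a; a.+1]; split=> //=.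
- by rewrite ltnSn.
- by rewrite !big_cons big_nil mulr1 XsubC_natS.
- by move=> x; rewrite PE !hornerE; exact: consecutive_roots_ge0.
Qed.

Lemma monic_nonneg3 (R : realType) (P : {poly R}) :
  monic_nonneg 3 P <->
  exists2 a : nat, (0 < a)%N & P = 'X * ('X - a%:R%:P) * ('X - a%:R%:P - 1).
Proof.
split=> [/monic_nonnegP[s [+ + PE P0]]|[a a0 PE]].
  case: s PE => [|a [|b [|c []]]]//= PE /[1!andbT] /andP[ab bc] _.
  have ab' : a%:R + 1 <= b%:R :> R by rewrite natr1 ler_nat.
  have cE : c = b.+1.
    apply/eqP; rewrite eqn_leq bc andbT leqNgt; apply/negP => cb.
    (* Likewise [b + 1] would lie strictly between the two largest roots. *)
    have := P0 b.+1; rewrite PE !big_cons big_nil !hornerE /= -natr1 leNgt.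
    move/negP; apply; rewrite mulr1 pmulr_rlt0; last by apply: mulr_gt0; lra.
    have : b%:R + 1 + 1 <= c%:R :> R by rewrite !natr1 ler_nat.
    lra.
  have aE : a = 0%N.
    apply/eqP; rewrite -leqn0 leqNgt; apply/negP => a0.
    (* At 0, below three positive roots, the cubic would be negative. *)
    have := P0 0%N; rewrite PE !big_cons big_nil !hornerE /= leNgt.
    move/negP; apply; rewrite mulr1 mulrNN mulrN oppr_lt0 !mulr_gt0 ?ltr0n//.
      exact: leq_ltn_trans ab.
    by rewrite cE.
  exists b; first by rewrite -aE.
  by rewrite PE aE cE !big_cons big_nil mulr1 XsubC_natS subr0 mulrA.
apply/monic_nonnegP; exists [:: 0; a; a.+1]%N; split=> //=.
- by rewrite a0 ltnSn.
- by rewrite !big_cons big_nil mulr1 XsubC_natS subr0 mulrA.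
- move=> x; rewrite PE !hornerE -mulrA mulr_ge0//.
  exact: consecutive_roots_ge0.
Qed.

(** * Values of [Lfun] on these polynomials *)

Lemma LfunX (R : realType) (n : nat) (m : n.+1.-tuple R) :
  Defs.Lfun 'X m = moment m 1.
Proof.
rewrite /Defs.Lfun (bigD1 (lift ord0 ord0))//= coefX mul1r big1 ?addr0// => k.
rewrite coefX => k1; rewrite (_ : (k == 1 :> nat) = false) ?mul0r//.
exact/negbTE.
Qed.

Lemma consecutive_rootsE (R : comNzRingType) (a : R) :
  ('X - a%:P) * ('X - a%:P - 1) = Poly [:: a * (a + 1); - (2 * a + 1); 1].
Proof. by rewrite /= !cons_poly_def; ring. Qed.

Lemma Lfun2 (R : realType) (a m1 m2 : R) :
  Defs.Lfun (('X - a%:P) * ('X - a%:P - 1)) [tuple m1; m2] =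
  m2 - (2 * a + 1) * m1 + a * (a + 1).
Proof.
rewrite consecutive_rootsE /Defs.Lfun !big_ord_recl big_ord0 !coef_Poly.
by rewrite /moment/=; ring.
Qed.

Lemma Lfun3 (R : realType) (a m1 m2 m3 : R) :
  Defs.Lfun ('X * ('X - a%:P) * ('X - a%:P - 1)) [tuple m1; m2; m3] =
  m3 - (2 * a + 1) * m2 + a * (a + 1) * m1.
Proof.
rewrite -mulrA consecutive_rootsE.
rewrite (_ : 'X * _ = Poly [:: 0; a * (a + 1); - (2 * a + 1); 1]); last first.
  by rewrite /= !cons_poly_def; ring.
by rewrite /Defs.Lfun !big_ord_recl big_ord0 !coef_Poly /moment/=; ring.
Qed.

Lemma Lfun1 (R : realType) (n : nat) (m : n.-tuple R) : Defs.Lfun 1 m = 1.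
Proof.
rewrite /Defs.Lfun big_ord_recl big1 ?addr0 ?coef1 ?mul1r// => k _.
by rewrite coef1 mul0r.
Qed.

Lemma monic_nonneg0 (R : realType) (P : {poly R}) : monic_nonneg 0 P -> P = 1.
Proof.
by case/monic_nonnegP => s [_ /size0nil -> ->]; rewrite big_nil.
Qed.

(** * Integers next to a real number *)

Lemma floor_itv_nat (R : realType) (x : R) : 0 <= x ->
  exists2 k : nat, (Num.floor x)%:~R = k%:R :> R & k%:R <= x < k%:R + 1.
Proof.
move=> x0; have := floor_itv x; rewrite -floor_ge0 in x0.
case: (Num.floor x) x0 => // k _ kx; exists k => //.
by rewrite intrD in kx.
Qed.

Lemma left_open_itv_nat (R : realType) (x : R) : 0 < x ->
  exists2 k : nat, k%:R < x <= k%:R + 1 &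
    (x - k%:R) * (k%:R + 1 - x) =
    (x - (Num.floor x)%:~R) * (1 - (x - (Num.floor x)%:~R)).
Proof.
move=> x0; have [k -> /andP[kx xk]] := floor_itv_nat (ltW x0).
have [xE|xk0] := eqVneq x k%:R.
  (* At an integer [x] the predecessor replaces the floor, and both products vanish. *)
  case: k xE {kx xk} => [|k] xE; first by rewrite xE ltxx in x0.
  exists k; first by rewrite xE -natr1; lra.
  by rewrite xE -natr1; ring.
exists k; last by ring.
by rewrite lt_neqAle eq_sym xk0 kx ltW.
Qed.

(** As a function of [a], the quadratic [a (a + 1) - (2 a + 1) x] has its vertex at [x - 1/2], and
    [k] is at distance at most 1/2 from it. It is used with [x = m1] and with [x = m2 / m1]. *)
Lemma consecutive_roots_min (R : realDomainType) (k a : nat) (x : R) :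
  k%:R <= x <= k%:R + 1 ->
  k%:R * (k%:R + 1) - (2 * k%:R + 1) * x <=
  a%:R * (a%:R + 1) - (2 * a%:R + 1) * x.
Proof.
move=> /andP[kx xk]; rewrite -subr_ge0.
rewrite (_ : _ - _ = (a%:R - k%:R) * (a%:R + k%:R + 1 - 2 * x)); last by ring.
have [ak|ka|->] := ltngtP a k; last by rewrite subrr mul0r.
  have : a%:R + 1 <= k%:R :> R by rewrite natr1 ler_nat.
  by move=> ?; rewrite mulr_le0//; lra.
have : k%:R + 1 <= a%:R :> R by rewrite natr1 ler_nat.
by move=> ?; rewrite mulr_ge0//; lra.
Qed.

(** * Construction of representing measures *)

Lemma realizable1 (R : realType) (m1 : R) : 0 < m1 -> realizable [tuple m1].
Proof.
move=> /left_open_itv_nat[k /andP[km mk] _].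
apply: (@realizable_atoms _ _ _ [:: (k%:R + 1 - m1, k); (m1 - k%:R, k.+1)]).
- by move=> p; rewrite !inE => /orP[]/eqP-> /=; lra.
- by rewrite !big_cons big_nil /=; ring.
- case=> [|[|]]// _; rewrite !big_cons big_nil /= -natr1 /moment /=; ring.
Qed.

(* Two masses at [k] and [k + 1] give the smallest second moment; the excess
   [e] is produced by a small mass at a distant point [k + 1 + j]. *)
Lemma realizable2 (R : realType) (k : nat) (m1 m2 : R) :
  k%:R < m1 <= k%:R + 1 -> 0 <= m2 - (2 * k%:R + 1) * m1 + k%:R * (k%:R + 1) ->
  realizable [tuple m1; m2].
Proof.
move=> /andP[km mk]; set e := (X in 0 <= X) => e0.
pose t := m1 - k%:R; have t0 : 0 < t by rewrite subr_gt0.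
(* Large enough that the mass [t - e / j] at [k + 1] stays nonnegative. *)
pose n := (Num.truncn (e / t)).+1; pose j : R := n%:R.
have j0 : 0 < j by rewrite ltr0n.
have ejt : e / j <= t.
  rewrite ler_pdivrMr// mulrC -ler_pdivrMr//; exact/ltW/truncnS_gt.
have j10 : 0 < j + 1 by lra.
(* The corrections [e / (j + 1)], [- e / j], [e / (j (j + 1))] at [k], [k + 1], [k + 1 + j] have
   total mass 0, first moment 0 and second moment [e]. *)
apply: (@realizable_atoms _ _ _ [:: (1 - t + e / (j + 1), k);
  (t - e / j, k.+1); (e / (j * (j + 1)), (k + 1 + n)%N)]).
- have ? : 0 <= e / (j + 1) by rewrite divr_ge0// ltW.
  have ? : 0 <= e / (j * (j + 1)) by rewrite divr_ge0// mulr_ge0// ltW.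
  by move=> p; rewrite !inE /t => /or3P[]/eqP-> //=; rewrite /t in ejt *; lra.
- rewrite !big_cons big_nil /=; field.
  by rewrite !gt_eqF.
- case=> [|[|[|]]]// _; rewrite !big_cons big_nil /= !natrD -natr1 /moment /=.
    rewrite -/j /t; field; by rewrite !gt_eqF.
  rewrite -/j /t /e; field; by rewrite !gt_eqF.
Qed.

(* [x mu(dx) / m1] is the probability measure built in [realizable2] for the
   moments [m2 / m1] and [m3 / m1]; the remaining mass of [mu] sits at [0] and
   is nonnegative for large [j] because [m2] is not minimal. *)
Lemma realizable3 (R : realType) (k : nat) (m1 m2 m3 : R) : (0 < k)%N ->
  k%:R * m1 < m2 <= (k%:R + 1) * m1 ->
  0 < m2 - (2 * k%:R + 1) * m1 + k%:R * (k%:R + 1) ->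
  0 <= m3 - (2 * k%:R + 1) * m2 + k%:R * (k%:R + 1) * m1 ->
  realizable [tuple m1; m2; m3].
Proof.
move=> k0 /andP[km mk]; set d := (X in 0 < X) => d0.
set e := (X in 0 <= X) => e0.
pose t := m2 - k%:R * m1; have t0 : 0 < t by rewrite subr_gt0.
(* One bound for two needs: [e / t] for the mass at [k + 1], [e / d] for the mass at 0. *)
pose n := (Num.truncn (e / t + e / d)).+1; pose j : R := n%:R.
pose K : R := k%:R; have K0 : 0 < K by rewrite ltr0n.
have j0 : 0 < j by rewrite ltr0n.
have et0 : 0 <= e / t by rewrite divr_ge0// ltW.
have ed0 : 0 <= e / d by rewrite divr_ge0// ltW.
have jlt : e / t + e / d < j by exact: truncnS_gt.
have ejt : e / j <= t by rewrite ler_pdivrMr// mulrC -ler_pdivrMr//; lra.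
have N0 : 0 < K + 1 + j by lra.
have end_ : e / (K + 1 + j) <= d.
  by rewrite ler_pdivrMr// mulrC -ler_pdivrMr//; lra.
have j10 : 0 < j + 1 by lra.
have K10 : 0 < K + 1 by lra.
pose p1 := (m1 - t + e / (j + 1)) / K.
pose p2 := (t - e / j) / (K + 1).
pose p3 := e / (j * (j + 1)) / (K + 1 + j).
(* Integrate [(x - k)(x - k - 1)], whose integral is [d]: it vanishes at [k] and [k + 1], is
   [K (K + 1)] at 0, and the distant atom contributes [j (j + 1) p3 = e / (K + 1 + j)]. *)
have p0E : 1 - p1 - p2 - p3 = (d - e / (K + 1 + j)) / (K * (K + 1)).
  by rewrite /p1 /p2 /p3 /d /t -/K; field; rewrite !gt_eqF.
have p00 : 0 <= 1 - p1 - p2 - p3.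
  by rewrite p0E divr_ge0 ?subr_ge0// mulr_ge0// ltW.
have p10 : 0 <= p1.
  rewrite divr_ge0 ?(ltW K0)// addr_ge0 ?divr_ge0 ?(ltW j10)//.
  by rewrite /t -/K in mk *; lra.
have p20 : 0 <= p2 by rewrite divr_ge0 ?subr_ge0// ltW.
have p30 : 0 <= p3.
  by rewrite divr_ge0 ?(ltW N0)// divr_ge0// mulr_ge0// ltW.
apply: (@realizable_atoms _ _ _ [:: (1 - p1 - p2 - p3, 0%N); (p1, k);
  (p2, k.+1); (p3, (k + 1 + n)%N)]).
- by move=> p; rewrite !inE => /or4P[]/eqP->.
- by rewrite !big_cons big_nil /=; ring.
- case=> [|[|[|[|]]]]// _;
    rewrite !big_cons big_nil /= !natrD -natr1 /moment /= -/j -/K /p1 /p2 /p3.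
  + by rewrite /t; field; rewrite !gt_eqF.
  + by rewrite /t -/K; field; rewrite !gt_eqF.
  + by rewrite /e /t -/K; field; rewrite !gt_eqF.
Qed.

(** * I-realizability as explicit inequalities *)

Lemma I_realizable1 (R : realType) (m1 : R) :
  I_realizable [tuple m1] <-> 0 < m1.
Proof.
split=> [[_ L0]|m10].
  by have := L0 'X (or_introl ((monic_nonneg1 _).2 erefl)); rewrite LfunX.
split=> [|P [/monic_nonneg1 ->|/monic_nonneg0 ->]]; first exact: realizable1.
  by rewrite LfunX.
by rewrite Lfun1.
Qed.

Lemma I_realizable2 (R : realType) (m1 m2 : R) :
  I_realizable [tuple m1; m2] <->
  [/\ realizable [tuple m1; m2], 0 < m1 &
    forall a : nat, 0 < m2 - (2 * a%:R + 1) * m1 + a%:R * (a%:R + 1)].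
Proof.
split=> [[r L0]|[r m10 L0]]; split=> //.
- by have := L0 'X (or_intror ((monic_nonneg1 _).2 erefl)); rewrite LfunX.
- move=> a; rewrite -Lfun2; apply: L0; left.
  by apply/monic_nonneg2; exists a.
- move=> P [/monic_nonneg2[a ->]|/monic_nonneg1 ->]; first by rewrite Lfun2.
  by rewrite LfunX.
Qed.

Lemma I_realizable3 (R : realType) (m1 m2 m3 : R) :
  I_realizable [tuple m1; m2; m3] <->
  [/\ realizable [tuple m1; m2; m3],
    forall a : nat, 0 < m2 - (2 * a%:R + 1) * m1 + a%:R * (a%:R + 1) &
    forall a : nat, (0 < a)%N ->
      0 < m3 - (2 * a%:R + 1) * m2 + a%:R * (a%:R + 1) * m1].
Proof.
(* A quadratic does not see [m3], so P_2 gives the same conditions as for two moments. *)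
have L23 (a : R) :
    Defs.Lfun (('X - a%:P) * ('X - a%:P - 1)) [tuple m1; m2; m3] =
    m2 - (2 * a + 1) * m1 + a * (a + 1).
  rewrite consecutive_rootsE /Defs.Lfun !big_ord_recl big_ord0 !coef_Poly.
  by rewrite /moment/=; ring.
split=> [[r L0]|[r L2 L3]]; split=> //.
- move=> a; rewrite -L23; apply: L0; right.
  by apply/monic_nonneg2; exists a.
- move=> a a0; rewrite -Lfun3; apply: L0; left.
  by apply/monic_nonneg3; exists a.
- move=> P [/monic_nonneg3[a a0 ->]|/monic_nonneg2[a ->]].
    by rewrite Lfun3; exact: L3.
  by rewrite L23.
Qed.

(** * Minimizing polynomials and the criteria *)

Lemma minimizing2 (R : realType) (m1 m2 : R) (k : nat) :
  k%:R <= m1 <= k%:R + 1 ->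
  minimizing [tuple m1; m2] (('X - k%:R%:P) * ('X - k%:R%:P - 1)).
Proof.
move=> km; split; first by apply/monic_nonneg2; exists k.
move=> Q /monic_nonneg2[a ->]; rewrite !Lfun2.
have := consecutive_roots_min a km; lra.
Qed.

Lemma minimizing3 (R : realType) (m1 m2 m3 : R) (k : nat) : (0 < k)%N ->
  0 < m1 -> k%:R <= m2 / m1 <= k%:R + 1 ->
  minimizing [tuple m1; m2; m3] ('X * ('X - k%:R%:P) * ('X - k%:R%:P - 1)).
Proof.
move=> k0 m10 km; split; first by apply/monic_nonneg3; exists k.
move=> Q /monic_nonneg3[a _ ->]; rewrite !Lfun3.
(* Up to the common term [m3], the value of [Lfun] is [m1] times the quadratic of
   [consecutive_roots_min] at [x = m2 / m1]. *)
have := consecutive_roots_min a km; rewrite -(ler_pM2l m10).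
have -> : m2 = m2 / m1 * m1 by rewrite divfK ?gt_eqF.
rewrite mulfK ?gt_eqF//; lra.
Qed.

(** For the roots [k], [k + 1], [Lfun] equals [m2 - m1 ^+ 2 - (m1 - k) (k + 1 - m1)], so the
    inequality says that it is nonnegative. *)
Lemma realizable2P (R : realType) (m1 m2 : R) :
  let theta1 := m1 - (Num.floor m1)%:~R in 0 < m1 ->
  realizable [tuple m1; m2] <-> theta1 * (1 - theta1) <= m2 - m1 ^+ 2.
Proof.
move=> theta1 m10; have [k km kE] := left_open_itv_nat m10.
rewrite -kE; split=> [|h]; last by apply: (realizable2 km); lra.
have := @realizable_Lfun_ge0 _ _ [tuple m1; m2]
  (('X - k%:R%:P) * ('X - k%:R%:P - 1)).
have [_ -> _ P0] : monic_nonneg 2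
    (('X - k%:R%:P) * ('X - k%:R%:P - 1) : {poly R}).
  by apply/monic_nonneg2; exists k.
by move=> /(_ isT P0) /[apply]; rewrite Lfun2; lra.
Qed.

Lemma I_realizable2P (R : realType) (m1 m2 : R) :
  let theta1 := m1 - (Num.floor m1)%:~R in 0 < m1 ->
  I_realizable [tuple m1; m2] <-> theta1 * (1 - theta1) < m2 - m1 ^+ 2.
Proof.
move=> theta1 m10; have [k km kE] := left_open_itv_nat m10.
rewrite I_realizable2; split=> [[_ _ /(_ k)]|h]; first by rewrite -kE; lra.
split=> // [|a]; first by apply/realizable2P => //; exact: ltW.
have km' : k%:R <= m1 <= k%:R + 1 by case/andP: km => /ltW -> ->.
by have := consecutive_roots_min a km'; rewrite -kE in h; lra.
Qed.

(** The roots 0 and 1 give [m2 - m1 > 0]. This forces [k >= 1] below, so that 0, [k], [k + 1] are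
    distinct. *)
Lemma I_realizable2_lt (R : realType) (m1 m2 : R) :
  I_realizable [tuple m1; m2] -> 0 < m1 /\ 1 < m2 / m1.
Proof.
move=> /I_realizable2[_ m10 /(_ 0%N) h]; split=> //.
by rewrite ltr_pdivlMr//; lra.
Qed.

Lemma realizable3P (R : realType) (m1 m2 m3 : R) :
  let theta2 := m2 / m1 - (Num.floor (m2 / m1))%:~R in
  I_realizable [tuple m1; m2] ->
  realizable [tuple m1; m2; m3] <->
    theta2 * (1 - theta2) <= m3 / m1 - (m2 / m1) ^+ 2.
Proof.
move=> theta2 I2; have [m10 m21] := I_realizable2_lt I2.
have [k km kE] := left_open_itv_nat (lt_trans ltr01 m21).
have k0 : (0 < k)%N.
  rewrite -(ltr_nat R); move: km => /andP[_]; lra.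
rewrite -kE -subr_ge0 -(pmulr_rge0 _ m10).
rewrite (_ : m1 * _ = m3 - (2 * k%:R + 1) * m2 + k%:R * (k%:R + 1) * m1);
  last by field; rewrite gt_eqF.
split=> [|h].
  have := @realizable_Lfun_ge0 _ _ [tuple m1; m2; m3]
    ('X * ('X - k%:R%:P) * ('X - k%:R%:P - 1)).
  have [_ -> _ P0] : monic_nonneg 3
      ('X * ('X - k%:R%:P) * ('X - k%:R%:P - 1) : {poly R}).
    by apply/monic_nonneg3; exists k.
  by move=> /(_ isT P0) /[apply]; rewrite Lfun3.
have /I_realizable2[_ _ L2] := I2.
apply: (realizable3 k0 _ (L2 k) h).
by rewrite -ltr_pdivlMr// -ler_pdivrMr.
Qed.

Lemma I_realizable3P (R : realType) (m1 m2 m3 : R) :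
  let theta2 := m2 / m1 - (Num.floor (m2 / m1))%:~R in
  I_realizable [tuple m1; m2] ->
  I_realizable [tuple m1; m2; m3] <->
    theta2 * (1 - theta2) < m3 / m1 - (m2 / m1) ^+ 2.
Proof.
move=> theta2 I2; have [m10 m21] := I_realizable2_lt I2.
have [k km kE] := left_open_itv_nat (lt_trans ltr01 m21).
have k0 : (0 < k)%N.
  rewrite -(ltr_nat R); move: km => /andP[_]; lra.
have km' : k%:R <= m2 / m1 <= k%:R + 1 by case/andP: km => /ltW -> ->.
have LE : (theta2 * (1 - theta2) < m3 / m1 - (m2 / m1) ^+ 2) =
    (0 < m3 - (2 * k%:R + 1) * m2 + k%:R * (k%:R + 1) * m1).
  rewrite -kE -subr_gt0 -(pmulr_rgt0 _ m10); congr (_ < _).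
  by field; rewrite gt_eqF.
rewrite I_realizable3; split=> [[_ _ /(_ k k0)]|h]; first by rewrite LE.
have /I_realizable2[_ _ L2] := I2.
split=> // [|a a0]; first by apply/realizable3P => //; exact: ltW.
(* Positivity at the minimizing cubic passes to all of P_3. *)
rewrite LE -Lfun3 in h; apply: (lt_le_trans h).
rewrite -Lfun3; apply: (minimizing3 _ k0 m10 km').2.
by apply/monic_nonneg3; exists a.
Qed.
Theorem theorem5p1 (R : realType) :
  (forall m1 : R, I_realizable [tuple m1] <-> 0 < m1) /\
  (forall m1 m2 : R,
    let k1 : R := (Num.floor m1)%:~R in
    let theta1 : R := m1 - k1 in
    I_realizable [tuple m1] ->
    [/\ minimizing [tuple m1; m2] (('X - k1%:P) * ('X - k1%:P - 1)),
        (realizable [tuple m1; m2] <->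
           theta1 * (1 - theta1) <= m2 - m1 ^+ 2),
        (theta1 * (1 - theta1) < m2 - m1 ^+ 2 ->
           I_realizable [tuple m1; m2]) &
        (m2 - m1 ^+ 2 = theta1 * (1 - theta1) ->
           B_realizable [tuple m1; m2])]) /\
  (forall m1 m2 : R,
    let theta1 : R := m1 - (Num.floor m1)%:~R in
    I_realizable [tuple m1; m2] <->
      (0 < m1 /\ theta1 * (1 - theta1) < m2 - m1 ^+ 2)) /\
  (forall m1 m2 m3 : R,
    let k2 : R := (Num.floor (m2 / m1))%:~R in
    let theta2 : R := m2 / m1 - k2 in
    I_realizable [tuple m1; m2] ->
    [/\ minimizing [tuple m1; m2; m3]
          ('X * ('X - k2%:P) * ('X - k2%:P - 1)),
        (realizable [tuple m1; m2; m3] <->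
           theta2 * (1 - theta2) <= m3 / m1 - (m2 / m1) ^+ 2) &
        (realizable [tuple m1; m2; m3] ->
           (theta2 * (1 - theta2) < m3 / m1 - (m2 / m1) ^+ 2 ->
              I_realizable [tuple m1; m2; m3]) /\
           (~ (theta2 * (1 - theta2) < m3 / m1 - (m2 / m1) ^+ 2) ->
              B_realizable [tuple m1; m2; m3]))]).
Proof.
split; first exact: I_realizable1.
split; last split.
- move=> m1 m2 k1 theta1 /I_realizable1 m10; split.
  (* The floor itself is used here; [minimizing2] accepts both ends of the closed interval, since at
     an integer [m1] two values of [k] attain the minimum. *)
  + have [k kE /andP[km mk]] := floor_itv_nat (ltW m10).
    by rewrite /k1 kE; apply: minimizing2; rewrite km ltW.
  + exact: realizable2P.
  + by move=> h; apply/I_realizable2P.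
  + move=> h; split; first by apply/realizable2P; rewrite // h.
    by move/I_realizable2P => /(_ m10); rewrite h ltxx.
- move=> m1 m2 theta1; split=> [I2|[m10 h]]; last exact/I_realizable2P.
  have [_ m10 _] := (I_realizable2 _ _).1 I2.
  by split=> //; apply/I_realizable2P.
- move=> m1 m2 m3 k2 theta2 I2; have [m10 m21] := I_realizable2_lt I2; split.
  + have [k kE /andP[km mk]] := floor_itv_nat (ltW (lt_trans ltr01 m21)).
    rewrite /k2 kE; apply: minimizing3; rewrite // ?km ?ltW//.
    by rewrite -(ltr_nat R); lra.
  + exact: realizable3P.
  + move=> r; split=> [h|h]; first exact/I_realizable3P.
    by split=> // /I_realizable3P => /(_ I2).
Qed.
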